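(* Let $(X,d)$ be a metric space and let $G$ be a continuous semigroup on $X$. Then every strongly nonwandering point for $G$ is a chain recurrent point for $G$, i.e. $\Omega_S(G)\subseteq CR(G)$.
   Context: A continuous semigroup $G$ on $X$ is a set of (non-identity) continuous self maps of $X$ closed under composition. Write $\widehat G = G\cup\{\mathrm{identity}\}$. A point $x\in X$ is a strongly nonwandering point for $G$ if for each neighborhood $U$ of $x$ and each $g\in G$ there is some $h\in\widehat G$ with $(h\circ g)(U)\cap U\neq\emptyset$. $\Omega_S(G)$ denotes the set of all strongly nonwandering points for $G$. Given $a,b\in X$, $g\in G$ and $\epsilon>0$, an $(\epsilon,g)$-chain from $a$ to $b$ is a finite sequence $(a=x_1,\ldots,x_{n+1}=b;\,g_1,\ldots,g_n)$ (with $n\ge 1$), where $x_i\in X$ and $g_i\in\widehat G$, such that $d(g_i(g(x_i)),x_{i+1})<\epsilon$ for $i=1,\ldots,n$. A point $x\in X$ is a chain recurrent point for $G$ if for every $\epsilon>0$ and every $g\in G$ there exists an $(\epsilon,g)$-chain from $x$ to itself. $CR(G)$ denotes the set of all chain recurrent points for $G$. *)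

(* Defs.v *)
From HB Require Import structures.
From mathcomp Require Import all_boot all_order all_algebra.
From mathcomp Require Import all_classical all_reals all_analysis.

Set Implicit Arguments.
Unset Strict Implicit.
Unset Printing Implicit Defensive.

Import Order.TTheory GRing.Theory Num.Theory.

Local Open Scope classical_set_scope.
Local Open Scope ring_scope.

Record continuous_semigroup (X : topologicalType) (G : set (X -> X)) : Prop :=
  ContinuousSemigroup {
    csg_continuous : forall g, G g -> continuous g ;
    csg_comp : forall g h, G g -> G h -> G (g \o h) ;
    csg_nonid : ~ G idfun }.

Definition with_id (X : Type) (G : set (X -> X)) : set (X -> X) :=
  G `|` [set idfun].

Definition strongly_nonwandering (X : topologicalType) (G : set (X -> X)) :
    set X :=
  [set x | forall U : set X, nbhs x U -> forall g, G g ->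
     exists2 h, with_id G h & ((h \o g) @` U) `&` U !=set0].

(* The points x_1, ..., x_{n+1} are xs 0, ..., xs n and the maps g_1, ..., g_n
   are gs 0, ..., gs (n-1); the successor index of i : 'I_n is lift ord0 i. *)
Definition is_chain (R : realType) (X : metricType R) (G : set (X -> X))
    (eps : R) (g : X -> X) (a b : X)
    (n : nat) (xs : 'I_n.+1 -> X) (gs : 'I_n -> X -> X) : Prop :=
  [/\ (1 <= n)%N, xs ord0 = a, xs ord_max = b,
      forall i : 'I_n, with_id G (gs i) &
      forall i : 'I_n,
        mdist (gs i (g (xs (widen_ord (leqnSn n) i)))) (xs (lift ord0 i)) < eps].

Definition chain_recurrent (R : realType) (X : metricType R)
    (G : set (X -> X)) : set X :=
  [set x | forall eps : R, 0 < eps -> forall g, G g ->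
     exists (n : nat) (xs : 'I_n.+1 -> X) (gs : 'I_n -> X -> X),
       is_chain G eps g x x xs gs].

(* Main.v *)
Require Import Defs.
From mathcomp Require Import all_boot all_order all_algebra.
From mathcomp Require Import all_classical all_reals all_analysis.

Local Open Scope classical_set_scope.

(* For [u] near [x] with [h (g (g u))] near [x], the sequence
   [(x, g u, x; id, h)] is a chain. Applying the nonwandering hypothesis to
   [g \o g] rather than [g] leaves continuity to be used only for [g], which
   is chosen before the neighborhood, and not for [h], which depends on it. *)

Theorem proposition4p6 (R : realType) (X : metricType R) (G : set (X -> X))
    (hG : continuous_semigroup G) :
  strongly_nonwandering G `<=` chain_recurrent G.
Proof.
move=> x xnw eps eps0 g Gg.
(* The first factor will control the closing jump back to [x], the second the opening jump from
   [g x] to [g u]. *)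
have Unbhs : nbhs x (ball x eps `&` g @^-1` ball (g x) eps).
  apply: filterI; first exact: nbhsx_ballx.
  exact/(csg_continuous hG Gg)/nbhsx_ballx.
have [h Gh [_ [[u [_ gu] <-] [hu _]]]] := xnw _ Unbhs _ (csg_comp hG Gg Gg).
(* The [else] branch of the points serves both endpoints, indices 0 and 2. *)
exists 2, (fun i => if val i == 1 then g u else x),
  (fun i => if val i == 0 then idfun else h).
split=> // i; first by case: eqP => // _; right.
(* Each link applies [g] before its own map: link 0 compares [g x] with [g u], and link 1, starting
   at [g u], supplies the second [g] in [h (g (g u))]. *)
case: i => [[|[|//]]] ilt /=.
  by move: gu; rewrite /= ballEmdist.
by move: hu; rewrite ballEmdist /= metric_sym.
Qed.
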